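(* For any fair-goods instance with two agents, there exists an allocation $\mathbf O=(O_1,O_2)$ that is simultaneously MMS and PROP1 and that, moreover, maximizes the egalitarian welfare among all allocations and satisfies $\mathsf{UW}(\mathbf O)\ge 1$.
   Context: A fair-goods instance with two agents consists of agents $N=\{1,2\}$, indivisible items $E=\{e_1,\dots,e_m\}$ placed on a path in this order, and for each agent $i$ an additive valuation $v_i$ (i.e. $v_i(S)=\sum_{e\in S}v_i(e)$) with $v_i(e)\ge 0$ for all $e\in E$, normalized so that $v_i(\emptyset)=0$, $v_i(E)=1$. A bundle is connected if it is a set of consecutive items (the empty set is allowed). An allocation $\mathbf A=(A_1,A_2)$ is a partition of $E$ into two disjoint connected (possibly empty) bundles, $A_i$ being given to agent $i$ (either agent's bundle may be the left one). Its utilitarian welfare is $\mathsf{UW}(\mathbf A)=v_1(A_1)+v_2(A_2)$ and its egalitarian welfare is $\mathsf{EW}(\mathbf A)=\min\{v_1(A_1),v_2(A_2)\}$. The maximin share of agent $i$ is $\mathsf{MMS}_i=\max_{(X_1,X_2)}\min\{v_i(X_1),v_i(X_2)\}$ over all partitions of $E$ into two connected (possibly empty) bundles. An allocation is MMS if $v_i(A_i)\ge\mathsf{MMS}_i$ for both $i$. An allocation is PROP1 if for each $i$, either $v_i(A_i)\ge\frac12$, or there is $e\in E\setminus A_i$ such that $A_i\cup\{e\}$ is connected and $v_i(A_i\cup\{e\})\ge\frac12$. *)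

(* Defs.v *)
From HB Require Import structures.
From mathcomp Require Import all_boot all_order all_algebra.

Set Implicit Arguments.
Unset Strict Implicit.
Unset Printing Implicit Defensive.

Import Order.TTheory GRing.Theory Num.Theory.
Local Open Scope ring_scope.

(* The items are the elements of 'I_m, ordered along the path by their value
   in nat; the two agents are the elements of 'I_2. *)

Section FairGoods.

Variables (R : realFieldType) (m : nat).
Implicit Types (S : {set 'I_m}) (A X : {ffun 'I_2 -> {set 'I_m}}).
Implicit Types (u : 'I_m -> R) (v : 'I_2 -> 'I_m -> R).

Definition bundle_value u S : R := \sum_(e in S) u e.

Definition connected_bundle S : bool :=
  [forall i in S, forall k in S, forall j : 'I_m,
     (i <= j <= k)%N ==> (j \in S)].

(* Not [partition] from finset, which forbids empty blocks. *)
Definition is_allocation A : bool :=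
  [&& [forall i, connected_bundle (A i)],
      [disjoint A ord0 & A ord_max] &
      A ord0 :|: A ord_max == [set: 'I_m]].

Definition utilitarian_welfare v A : R := \sum_(i < 2) bundle_value (v i) (A i).

Definition egalitarian_welfare v A : R :=
  Num.min (bundle_value (v ord0) (A ord0)) (bundle_value (v ord_max) (A ord_max)).

(* The default value of the maximum is the one of the split (set0, setT), which
   is itself one of the splits over which the maximum is taken. *)
Definition maximin_share u : R :=
  \big[Num.max/Num.min (bundle_value u set0) (bundle_value u [set: 'I_m])]_
     (X : {ffun 'I_2 -> {set 'I_m}} | is_allocation X)
     Num.min (bundle_value u (X ord0)) (bundle_value u (X ord_max)).

Definition is_MMS v A : Prop :=
  forall i, maximin_share (v i) <= bundle_value (v i) (A i).

Definition is_PROP1 v A : Prop :=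
  forall i, 2^-1 <= bundle_value (v i) (A i) \/
    exists e, [/\ e \notin A i, connected_bundle (e |: A i) &
                  2^-1 <= bundle_value (v i) (e |: A i)].

Definition maximizes_egalitarian_welfare v A : Prop :=
  is_allocation A /\
  forall B, is_allocation B -> egalitarian_welfare v B <= egalitarian_welfare v A.

End FairGoods.

(* Main.v *)
Require Import Defs.
From HB Require Import structures.
From mathcomp Require Import all_boot all_order all_algebra.
From mathcomp Require Import lra.

(** Every allocation maximizing the egalitarian welfare EW works, up to zero-valued
    items.  It has utilitarian welfare at least 1, since otherwise exchanging the two
    bundles would increase EW.  It is MMS, since cut-and-choose at a maximin
    split of agent i gives i at least MMS_i and the other agent at least 1/2, so that
    the maximal EW is at least MMS_i.  If some agent i gets less than 1/2, choose a
    maximizer in which the bundle of i is moreover as large as possible.  If it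
    were still worth less than 1/2 after adding the next item, the other agent's
    remaining bundle would either be worth at most 1/2, and exchanging would give
    both agents at least 1/2, or more than 1/2, and the enlarged bundle would be that
    of another maximizer; both are impossible. *)

Set Implicit Arguments.
Unset Strict Implicit.
Unset Printing Implicit Defensive.

Import Order.TTheory GRing.Theory Num.Theory.
Local Open Scope ring_scope.

Section Splits.

Variable m : nat.
Implicit Types (S : {set 'I_m}) (A : {ffun 'I_2 -> {set 'I_m}}) (i : 'I_2).

(** With two agents either bundle determines the allocation, so allocations are handled through a
    single bundle. *)
Definition is_split S := connected_bundle S && connected_bundle (~: S).

Definition down_closed S := forall a b : 'I_m, b \in S -> (a <= b)%N -> a \in S.

Lemma connected_bundleP S :
  reflect (forall a b c : 'I_m, a \in S -> c \in S -> (a <= b <= c)%N -> b \in S)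
          (connected_bundle S).
Proof.
apply: (iffP idP) => [/forall_inP cS a b c aS cS' abc | cS].
  by have /forall_inP/(_ c cS')/forallP/(_ b)/implyP := cS a aS; apply.
apply/forall_inP => a aS; apply/forall_inP => c cS'; apply/forallP => b.
by apply/implyP; exact: cS.
Qed.

Lemma splitC S : is_split (~: S) = is_split S.
Proof. by rewrite /is_split setCK andbC. Qed.

Lemma down_closed_split S : down_closed S -> is_split S.
Proof.
move=> dS; apply/andP; split; apply/connected_bundleP => a b c.
  by move=> _ cS /andP[_ bc]; exact: dS bc.
by rewrite !inE => aS _ /andP[ab _]; apply: contra aS => bS; exact: dS ab.
Qed.

(** If both failed, there would be [k <= i] with only [i] in [S], and [a <= b] with only [a] in [S].
    If [i <= b], the complement has a gap at [i]; otherwise [S] has a gap at [b]. *)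
Lemma split_down_closed S : is_split S -> down_closed S \/ down_closed (~: S).
Proof.
case/andP=> /connected_bundleP cS /connected_bundleP cSC.
case: (boolP [forall b in S, forall a : 'I_m, (a <= b)%N ==> (a \in S)]).
  move=> /forall_inP dS; left => a b bS ab.
  by have /forallP/(_ a)/implyP := dS b bS; apply.
move=> /forall_inPn[i iS /forallPn[k]]; rewrite negb_imply => /andP[ki kS].
right=> a b; rewrite !inE => bS ab; apply/negP => aS.
case: (leqP i b) => [ib | /ltnW bi].
  by have := cSC k i b; rewrite !inE kS bS ki ib iS => /(_ isT isT isT).
by move/negP: bS; apply; apply: (cS a b i) => //; rewrite ab.
Qed.

(** A prefix is extended by the first missing item, a suffix by the last missing one. *)
Lemma split_add S : is_split S -> S != [set: 'I_m] ->
  exists2 e, e \notin S & is_split (e |: S).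
Proof.
move=> spS; rewrite -subTset => /subsetPn[x _ xS].
case: (split_down_closed spS) => dS.
  case: (arg_minnP (P := fun y : 'I_m => y \notin S) val xS) => e eS e_min.
  exists e => //; apply: down_closed_split => a b.
  rewrite !inE => /orP[/eqP-> ae | bS ab]; last by rewrite (dS a b) ?orbT.
  have [aS|aS] := boolP (a \in S); first by rewrite orbT.
  by rewrite orbF; apply/eqP/val_inj/anti_leq; rewrite ae; exact: e_min.
case: (arg_maxnP (P := fun y : 'I_m => y \notin S) val xS) => e eS e_max.
exists e => //; rewrite -splitC; apply: down_closed_split => a b.
rewrite !inE !negb_or => /andP[be bS] ab.
have aS : a \notin S by have := dS a b; rewrite !inE; apply.
rewrite aS andbT; apply: contra be => /eqP ae; apply/eqP/val_inj/anti_leq.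
by rewrite -ae ab andbT ae; exact: e_max.
Qed.

Lemma ord2P i : i = ord0 \/ i = ord_max.
Proof. by case: i => [[|[|//]] ?]; [left|right]; apply: val_inj. Qed.

Lemma rev_ord0 : rev_ord (ord0 : 'I_2) = ord_max.
Proof. exact: val_inj. Qed.

Lemma rev_ord_max : rev_ord (ord_max : 'I_2) = ord0.
Proof. exact: val_inj. Qed.

(** Since [rev_ord i] is the agent other than [i], both agents can be treated by the same
    statements. *)
Definition give i S : {ffun 'I_2 -> {set 'I_m}} :=
  [ffun j => if j == i then S else ~: S].

Lemma give_self i S : give i S i = S.
Proof. by rewrite ffunE eqxx. Qed.

Lemma give_rev i S : give i S (rev_ord i) = ~: S.
Proof. by rewrite ffunE; case: (ord2P i) => ->. Qed.

Lemma is_allocation_give i S : is_allocation (give i S) = is_split S.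
Proof.
have -> : is_allocation (give i S) = [forall j, connected_bundle (give i S j)].
  rewrite /is_allocation -[RHS]andbT; congr (_ && _); apply/andP.
  by rewrite !ffunE; case: (ord2P i) => -> /=;
    rewrite -setI_eq0 ?[~: S :&: S]setIC ?[~: S :|: S]setUC setICr setUCr.
apply/forallP/andP => [cA | [cS cSC] j].
  by have := cA i; have := cA (rev_ord i); rewrite give_self give_rev.
by rewrite ffunE; case: ifP.
Qed.

Lemma allocation_give A i : is_allocation A -> A = give i (A i).
Proof.
case/and3P=> _; rewrite -setI_eq0 => /eqP dA /eqP uA.
have AC : A ord_max = ~: A ord0.
  apply/setP => x; move/setP/(_ x): dA; move/setP/(_ x): uA; rewrite !inE.
  by case: (x \in A ord0); case: (x \in A ord_max).
apply/ffunP => j; rewrite ffunE.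
by case: (ord2P i) => ->; case: (ord2P j) => -> //=; rewrite AC // setCK.
Qed.

Lemma allocation_rev A i : is_allocation A -> A (rev_ord i) = ~: A i.
Proof. by move=> /(allocation_give i) eqA; rewrite {1}eqA give_rev. Qed.

Lemma allocation_split A i : is_allocation A -> is_split (A i).
Proof. by move=> alA; rewrite -(is_allocation_give i) -allocation_give. Qed.

End Splits.

Section Welfare.

Variables (R : realFieldType) (m : nat) (v : 'I_2 -> 'I_m -> R).
Hypothesis v_ge0 : forall (i : 'I_2) (e : 'I_m), 0 <= v i e.
Hypothesis v_total : forall i : 'I_2, bundle_value (v i) [set: 'I_m] = 1.
Implicit Types (S : {set 'I_m}) (A : {ffun 'I_2 -> {set 'I_m}}) (i : 'I_2).

Local Notation bval i S := (bundle_value (v i) S).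
Local Notation EW := (egalitarian_welfare v).
Local Notation maxEW := (maximizes_egalitarian_welfare v).

Lemma bundle_valueC i S : bval i (~: S) = 1 - bval i S.
Proof.
rewrite -(v_total i) /bundle_value [in RHS](bigID (mem S)) /= addrAC.
under [X in _ = X - _ + _]eq_bigl do rewrite inE.
by rewrite subrr add0r; apply: eq_bigl => x; rewrite !inE.
Qed.

Lemma bundle_valueU1 i e S : bval i S <= bval i (e |: S).
Proof.
have [eS|eS] := boolP (e \in S); first by rewrite (setUidPr _) ?sub1set.
by rewrite /bundle_value big_setU1 //= lerDr.
Qed.

Lemma egalitarian_welfare_give i S :
  EW (give i S) = Num.min (bval i S) (1 - bval (rev_ord i) S).
Proof.
rewrite /egalitarian_welfare -bundle_valueC.
case: (ord2P i) => ->; rewrite ?rev_ord0 ?rev_ord_max !ffunE //=.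
by rewrite minC.
Qed.

Lemma egalitarian_welfareE A i : is_allocation A ->
  EW A = Num.min (bval i (A i)) (bval (rev_ord i) (A (rev_ord i))).
Proof.
move=> alA; rewrite {1}(allocation_give i alA) egalitarian_welfare_give.
by rewrite -bundle_valueC -allocation_rev.
Qed.

Lemma max_egalitarian_split A i S : maxEW A -> is_split S ->
  Num.min (bval i S) (1 - bval (rev_ord i) S) <= EW A /\
  Num.min (1 - bval i S) (bval (rev_ord i) S) <= EW A.
Proof.
case=> _ maxA spS; split.
  by rewrite -egalitarian_welfare_give; apply: maxA; rewrite is_allocation_give.
rewrite -bundle_valueC -[X in Num.min _ X](subKr 1) -bundle_valueC.
by rewrite -egalitarian_welfare_give; apply: maxA; rewrite is_allocation_give splitC.
Qed.

Lemma max_egalitarian_exists : exists A, maxEW A.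
Proof.
have al0 : is_allocation (give ord0 (set0 : {set 'I_m})).
  by rewrite is_allocation_give; apply: down_closed_split => a b; rewrite inE.
case: (arg_maxP EW al0) => A alA maxA.
by exists A; split=> // B; exact: maxA.
Qed.

Lemma max_egalitarian_utilitarian A : maxEW A -> 1 <= utilitarian_welfare v A.
Proof.
move=> mA; have alA := mA.1.
have [_] := max_egalitarian_split ord0 mA (allocation_split ord0 alA).
rewrite (egalitarian_welfareE ord0 alA) /utilitarian_welfare big_ord_recl big_ord1.
have -> : lift ord0 ord0 = rev_ord ord0 :> 'I_2 by exact: val_inj.
rewrite (allocation_rev ord0 alA) !bundle_valueC.
set a := bval _ _; set b := bval _ _.
(* Optimality against the exchange reads [min (1 - a) b <= min a (1 - b)]. Every case yields
   [b <= a], the mixed one through [b <= 1/2 <= a]. *)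
by rewrite le_min !ge_min => /andP[/orP[] + /orP[]]; lra.
Qed.

(* Cut and choose: agent [i] cuts at [S], the other agent chooses. *)
Lemma max_egalitarian_cut A i S : maxEW A -> is_split S ->
  Num.min (bval i S) (bval i (~: S)) <= EW A.
Proof.
move=> mA /(max_egalitarian_split i mA)[lS lSC]; rewrite bundle_valueC.
have [b_le|b_gt] := lerP (bval (rev_ord i) S) 2^-1.
  apply: le_trans lS; rewrite le_min !ge_min lexx /=.
  (* The cutter's worse piece is worth at most 1/2 to the cutter, hence no more than what the
     chooser gets. *)
  by case: (lerP (bval i S) 2^-1) => ?; apply/orP; [left|right]; lra.
apply: le_trans lSC; rewrite le_min !ge_min lexx orbT /=.
by case: (lerP (bval i S) 2^-1) => ?; apply/orP; [left|right]; lra.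
Qed.

Lemma max_egalitarian_MMS A : maxEW A -> is_MMS v A.
Proof.
move=> mA i; have le_EW : maximin_share (v i) <= EW A.
  apply: bigmax_le => [|X alX].
    (* The default value of the maximum is itself a cut, at the empty prefix. *)
    rewrite -setC0; apply: max_egalitarian_cut => //.
    by apply: down_closed_split => a b; rewrite inE.
  rewrite -rev_ord0 (allocation_rev ord0 alX).
  exact: max_egalitarian_cut (allocation_split _ alX).
apply: le_trans le_EW _.
by rewrite (egalitarian_welfareE i mA.1) ge_min lexx.
Qed.

(** Exchanging the enlarged bundles would leave [i] with more than 1/2, while [EW A < 1/2]. By
    optimality the other agent then values the enlarged bundle at most [EW A], so its complement at
    more than 1/2, and handing over [e] does not lower EW. *)
Lemma max_egalitarian_add A i e :
  maxEW A -> is_split (e |: A i) -> bval i (e |: A i) < 2^-1 ->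
  maxEW (give i (e |: A i)).
Proof.
move=> mA spS lt2; have le_e := bundle_valueU1 i e (A i).
have leA : EW A <= bval i (A i).
  by rewrite (egalitarian_welfareE i mA.1) ge_min lexx.
split=> [|B alB]; first by rewrite is_allocation_give.
apply: le_trans (mA.2 B alB) _; rewrite egalitarian_welfare_give le_min.
have [_] := max_egalitarian_split i mA spS.
by rewrite ge_min => /orP[] ?; apply/andP; split; lra.
Qed.

Lemma max_egalitarian_PROP1 : exists2 A, maxEW A & is_PROP1 v A.
Proof.
have [A mA] := max_egalitarian_exists.
have [/forallP ge2 | /forallPn[i]] := boolP [forall i, 2^-1 <= bval i (A i)].
  by exists A => // i; left.
rewrite -ltNge => lt2.
(* A boolean form of being a maximizer that leaves [i] below 1/2. *)
pose P B := [&& is_allocation B, EW A <= EW B & bval i (B i) < 2^-1].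
have PA : P A by rewrite /P mA.1 lexx.
have maxP B : is_allocation B -> EW A <= EW B -> maxEW B.
  by move=> alB le; split=> // C /mA.2 /le_trans; apply.
(* The number of items is maximized rather than their value: an added item may be worth zero. *)
case: (arg_maxnP (fun B : {ffun 'I_2 -> {set 'I_m}} => #|B i|) PA) => B /and3P[alB leB ltB] maxB.
have mB := maxP B alB leB; exists B => // j.
have [->|ji] := eqVneq j i.
  have neT : B i != [set: 'I_m].
    by apply: contraTneq ltB => ->; rewrite v_total; lra.
  have [e eB spe] := split_add (allocation_split i alB) neT.
  right; exists e; split=> //; first by case/andP: spe.
  rewrite leNgt; apply/negP => lte.
  have mC := max_egalitarian_add mB spe lte.
  have := maxB (give i (e |: B i)); rewrite /P mC.1 (mC.2 A mA.1) give_self lte.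
  by move=> /(_ isT); rewrite cardsU1 eB add1n /= ltnn.
(* The other agent makes up for the shortfall of [i], as the utilitarian welfare is at least 1. *)
left; have := max_egalitarian_utilitarian mB.
rewrite /utilitarian_welfare big_ord_recl big_ord1.
have -> : lift ord0 ord0 = ord_max :> 'I_2 by exact: val_inj.
by case: (ord2P i) ltB ji => ->; case: (ord2P j) => -> // ltB _; lra.
Qed.

End Welfare.

Theorem lemma23 (R : realFieldType) (m : nat) (v : 'I_2 -> 'I_m -> R)
    (v_ge0 : forall (i : 'I_2) (e : 'I_m), 0 <= v i e)
    (v_total : forall i : 'I_2, bundle_value (v i) [set: 'I_m] = 1) :
  exists O : {ffun 'I_2 -> {set 'I_m}},
    [/\ is_allocation O, is_MMS v O, is_PROP1 v O,
        maximizes_egalitarian_welfare v O & 1 <= utilitarian_welfare v O].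
Proof.
have [A mA pA] := max_egalitarian_PROP1 v_ge0 v_total.
exists A; split=> //; first exact: mA.1.
  exact: max_egalitarian_MMS.
exact: max_egalitarian_utilitarian.
Qed.
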